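(* Let $n,p\geq 2$ be integers. For $\{a,b\}\in E(\mathcal{T}_n^p)$ with $a<b$, put $$\tilde{\Psi}_n^p(a,b)=(\underbrace{1,\ldots,1}_{a-1},\,((b-a)\bmod p)+1,\,\underbrace{p,\ldots,p}_{\lfloor (b-a)/p\rfloor},\,\underbrace{1,\ldots,1}_{n-b}).$$ Then $\tilde{\Psi}_n^p$ is a bijection from $E(\mathcal{T}_n^p)$ to the set $\mathrm{JI}_n^p$ of join-irreducible elements of $\mathbb{F}_n^p$ under the dominance order. Its inverse is the map $\tilde{\Phi}_n^p:\mathrm{JI}_n^p\to E(\mathcal{T}_n^p)$ given by $\tilde{\Phi}_n^p(x)=\{k_x+1,\,n-m_x\}$, where $k_x$ (resp. $m_x$) is the maximal integer such that $x$ starts (resp. ends) with $k_x$ (resp. $m_x$) consecutive parts equal to $1$.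
   Context: **Turán graph.** $\mathcal{T}_n^p$ is the graph with vertex set $\{1,\ldots,n\}$ in which $\{a,b\}$ is an edge if and only if $a\not\equiv b \bmod p$. $E(\mathcal{T}_n^p)$ denotes its edge set. Here $r\bmod p$ denotes the remainder in $\{0,\ldots,p-1\}$. **Compositions and dominance order.** A composition of $n\ge 1$ is a tuple $(x_1,\ldots,x_m)$ of positive integers with $m\geq 1$ and $x_1+\cdots+x_m=n$. $\mathbb{F}_n^p$ is the set of compositions of $n$ all of whose parts satisfy $1\leq x_i\leq p$. It is ordered by the dominance order: $(x_1,\ldots,x_m)\leq (y_1,\ldots,y_\ell)$ iff $\sum_{i=1}^k x_i\leq\sum_{i=1}^k y_i$ for all $1\leq k\leq\min(m,\ell)$. With this order $\mathbb{F}_n^p$ is a finite distributive lattice. An element $x$ is a lower cover of $y$ if $x<y$ and $x\le z\le y$ implies $z\in\{x,y\}$. $\mathrm{JI}_n^p$ is the set of join-irreducible elements of $\mathbb{F}_n^p$, i.e. the elements having exactly one lower cover in $\mathbb{F}_n^p$. *)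

(* Defs.v *)
From HB Require Import structures.
From mathcomp Require Import all_boot all_order.
From mathcomp Require Export finmap.

Set Implicit Arguments.
Unset Strict Implicit.
Unset Printing Implicit Defensive.

Import Order.TTheory.

Local Open Scope fset_scope.

Definition turan_vertices (n : nat) : {fset nat} := [fset i in iota 1 n].

Definition turan_adj (p a b : nat) : bool := a != b %[mod p].

(* Edges are unordered pairs; a and b are automatically distinct, since
   turan_adj p is irreflexive. *)
Definition turan_edges (n p : nat) : {fset {fset nat}} :=
  [fset [fset a; b] | a in turan_vertices n, b in turan_vertices n
                    & turan_adj p a b].

Definition is_bcomp (n p : nat) (x : seq nat) : bool :=
  [&& 0 < size x, sumn x == n & all (fun i => 1 <= i <= p) x].

(* Compositions of n with all parts at most p. *)
Record bcomp (n p : nat) : Type :=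
  BComp { bcomp_seq :> seq nat; _ : is_bcomp n p bcomp_seq }.

HB.instance Definition _ (n p : nat) := [isSub for @bcomp_seq n p].
HB.instance Definition _ (n p : nat) := [Countable of bcomp n p by <:].

Definition dominated (x y : seq nat) : bool :=
  all (fun k => sumn (take k x) <= sumn (take k y))
      (iota 1 (minn (size x) (size y))).

Lemma leq_sumn_take (k : nat) (x : seq nat) : sumn (take k x) <= sumn x.
Proof. by rewrite -{2}(cat_take_drop k x) sumn_cat leq_addr. Qed.

Lemma dominatedP (x y : seq nat) : sumn x = sumn y ->
  reflect (forall k, sumn (take k x) <= sumn (take k y)) (dominated x y).
Proof.
move=> sxy; apply: (iffP allP) => [dom k|dom k _]; last exact: dom.
have dom' j : j <= size x -> j <= size y -> sumn (take j x) <= sumn (take j y).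
  case: j => [|j] jx jy; first by rewrite !take0.
  by apply: dom; rewrite mem_iota /= add1n ltnS leq_min jx jy.
case: (leqP (size y) k) => [yk|/ltnW ky].
  by rewrite (take_oversize yk) -sxy leq_sumn_take.
case: (leqP k (size x)) => [kx|/ltnW xk]; first exact: dom'.
rewrite (take_oversize xk).
have := dom' (size x) (leqnn _) (leq_trans xk ky); rewrite take_size.
move=> /leq_trans; apply; rewrite -{1}(subnKC xk) in ky *.
by rewrite -(subnKC xk) takeD sumn_cat leq_addr.
Qed.

Lemma eq_sumn_take (x y : seq nat) : all (leq 1) x -> all (leq 1) y ->
  (forall k, sumn (take k x) = sumn (take k y)) -> x = y.
Proof.
elim: x y => [|a x IHx] [|b y] //=.
- by move=> _ /andP[b0 _] /(_ 1); rewrite /= take0 /= addn0 => b0'; rewrite -b0' in b0.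
- by move=> /andP[a0 _] _ /(_ 1); rewrite /= take0 /= addn0 => a0'; rewrite a0' in a0.
move=> /andP[_ x0] /andP[_ y0] eq_xy.
have ab : a = b by have := eq_xy 1; rewrite /= !take0 /= !addn0.
subst b; congr (_ :: _); apply: IHx => // k.
by have /addnI := eq_xy k.+1.
Qed.

Lemma bcomp_sumn (n p : nat) (x : bcomp n p) : sumn x = n.
Proof. by case: x => x /= /and3P[_ /eqP]. Qed.

Lemma bcomp_parts (n p : nat) (x : bcomp n p) :
  all (fun i => 1 <= i <= p) x.
Proof. by case: x => x /= /and3P[]. Qed.

Lemma bcomp_gt0 (n p : nat) (x : bcomp n p) : all (leq 1) x.
Proof. by apply: sub_all (bcomp_parts x) => i /andP[]. Qed.

Lemma bcomp_dominatedP (n p : nat) (x y : bcomp n p) :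
  reflect (forall k, sumn (take k x) <= sumn (take k y)) (dominated x y).
Proof. by apply: dominatedP; rewrite !bcomp_sumn. Qed.

Definition bcomp_le (n p : nat) : rel (bcomp n p) := fun x y => dominated x y.

Lemma bcomp_le_refl (n p : nat) : reflexive (@bcomp_le n p).
Proof. by move=> x; apply/bcomp_dominatedP. Qed.

Lemma bcomp_le_anti (n p : nat) : antisymmetric (@bcomp_le n p).
Proof.
move=> x y /andP[/bcomp_dominatedP xy /bcomp_dominatedP yx].
apply/val_inj/eq_sumn_take; [exact: bcomp_gt0 | exact: bcomp_gt0 |].
by move=> k; apply/eqP; rewrite eqn_leq xy yx.
Qed.

Lemma bcomp_le_trans (n p : nat) : transitive (@bcomp_le n p).
Proof.
move=> y x z /bcomp_dominatedP xy /bcomp_dominatedP yz.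
by apply/bcomp_dominatedP => k; apply: leq_trans (xy k) (yz k).
Qed.

Fact dominance_display : Order.disp_t. Proof. exact: Order.Disp tt tt. Qed.

HB.instance Definition _ (n p : nat) :=
  Order.Le_isPOrder.Build dominance_display (bcomp n p)
    (@bcomp_le_refl n p) (@bcomp_le_anti n p) (@bcomp_le_trans n p).

Lemma size_leq_sumn (x : seq nat) : all (leq 1) x -> size x <= sumn x.
Proof.
by elim: x => //= a x IHx /andP[a0 /IHx]; rewrite -add1n; apply: leq_add.
Qed.

Lemma bcomp_size (n p : nat) (x : bcomp n p) : size x <= n.
Proof. by have := size_leq_sumn (bcomp_gt0 x); rewrite bcomp_sumn. Qed.

Definition bcomp_bseq (n p : nat) (x : bcomp n p) : n.-bseq 'I_p.+1 :=
  insub_bseq n (map inord x).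

Definition bseq_bcomp (n p : nat) (s : n.-bseq 'I_p.+1) : option (bcomp n p) :=
  insub (map val s).

Lemma bcomp_bseqK (n p : nat) : pcancel (@bcomp_bseq n p) (@bseq_bcomp n p).
Proof.
move=> x; rewrite /bseq_bcomp /bcomp_bseq /insub_bseq val_insubd.
rewrite size_map bcomp_size -map_comp (_ : map _ x = x) ?valK //.
rewrite -[RHS]map_id; apply/eq_in_map => i ix /=; rewrite inordK // ltnS.
by have /allP/(_ i ix)/andP[] := bcomp_parts x.
Qed.

HB.instance Definition _ (n p : nat) : isFinite (bcomp n p) :=
  PCanIsFinite (@bcomp_bseqK n p).

Definition lower_cover (n p : nat) (x y : bcomp n p) : bool :=
  (x < y)%O && [forall z, (x <= z <= y)%O ==> (z \in [:: x; y])].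

Definition join_irreducible (n p : nat) (x : bcomp n p) : bool :=
  #|[pred y | lower_cover y x]| == 1.

Definition join_irr (n p : nat) : Type :=
  {x : bcomp n p | join_irreducible x}.

(* Only meaningful for a < b in 1..n, where the truncated subtractions are
   exact. *)
Definition psi_seq (n p a b : nat) : seq nat :=
  nseq (a - 1) 1 ++ ((b - a) %% p).+1 :: nseq ((b - a) %/ p) p
    ++ nseq (n - b) 1.

Definition leading_ones (x : seq nat) : nat :=
  \max_(k < (size x).+1 | prefix (nseq k 1) x) k.

Definition trailing_ones (x : seq nat) : nat :=
  \max_(m < (size x).+1 | suffix (nseq m 1) x) m.

(* Main.v *)
(** Read a composition [x] through its partial sums, with [x_k = 0] past the
    end.  The dominance order compares partial sums pointwise, so the lower
    covers of [x] are obtained by decreasing one partial sum by one, i.e. by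
    moving a unit from [x_k] to [x_(k+1)]; this is possible exactly when
    [1 < x_k] and [x_(k+1) < p].  Hence [x] is join-irreducible iff it has
    exactly one such position, and scanning [x] from the right shows that this
    means [x = (1^i, c, p^j, 1^l)] with [1 < c <= p].  The pair [(i, l)]
    determines [c] and [j] by Euclidean division of [n - i - l - 1] by [p]. *)
Require Import Defs.
From mathcomp Require Import all_boot all_order finmap.
From mathcomp Require Import zify.

Set Implicit Arguments.
Unset Strict Implicit.
Unset Printing Implicit Defensive.


(** * Moving a unit from one part to the next *)

Definition descent (p : nat) (x : seq nat) (k : nat) : bool :=
  (1 < nth 0 x k) && (nth 0 x k.+1 < p).

(** If position [k] holds the last part, [head 0 t] supplies a [0] past the end, so the moved unit
    becomes a new last part [1]. *)
Fixpoint lower (k : nat) (x : seq nat) : seq nat :=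
  match k, x with
  | _, [::] => [::]
  | 0, c :: t => c.-1 :: (head 0 t).+1 :: behead t
  | k'.+1, a :: t => a :: lower k' t
  end.

(** Only the prefix of length [k.+1] contains the part losing the unit but not the place receiving
    it. *)
Lemma sumn_take_lower (k j : nat) (x : seq nat) : 1 < nth 0 x k ->
  sumn (take j (lower k x)) + (j == k.+1) = sumn (take j x).
Proof.
elim: k x j => [|k IHk] [|a x] [|j] //= xk; last by rewrite -addnA IHk.
case: j => [|j]; first by rewrite !take0 /=; lia.
by case: x => [|b x] /=; lia.
Qed.

Lemma sumn_lower (k : nat) (x : seq nat) : 1 < nth 0 x k ->
  sumn (lower k x) = sumn x.
Proof.
elim: k x => [|k IHk] [|a x] //= xk; last by rewrite IHk.
by case: x => [|b x] /=; lia.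
Qed.

Lemma parts_lower (p k : nat) (x : seq nat) : descent p x k ->
  all (fun i => 1 <= i <= p) x -> all (fun i => 1 <= i <= p) (lower k x).
Proof.
rewrite /descent; elim: k x => [|k IHk] [|a x] //= /andP[xk xk1].
  by case: x xk1 => [|b x] /= xk1; [lia | case/and3P => ? ? ->; lia].
by case/andP=> -> /IHk; apply; rewrite xk xk1.
Qed.

Lemma is_bcomp_lower (n p k : nat) (x : seq nat) : descent p x k ->
  is_bcomp n p x -> is_bcomp n p (lower k x).
Proof.
move=> dk /and3P[_ /eqP sx px]; apply/and3P; split; last exact: parts_lower.
- by move: dk; rewrite /descent; case: k x {sx px} => [|k] [|a x].
- by case/andP: dk => xk _; rewrite sumn_lower ?sx.
Qed.

(** * Partial sums and lower covers *)

Lemma sumn_takeS (x : seq nat) (k : nat) :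
  sumn (take k.+1 x) = sumn (take k x) + nth 0 x k.
Proof.
have [kx|xk] := ltnP k (size x).
  by rewrite (take_nth 0) // sumn_rcons.
by rewrite nth_default // addn0 !take_oversize // ltnW.
Qed.

Lemma descent_lt_size (p : nat) (x : seq nat) (k : nat) :
  descent p x k -> k < size x.
Proof. by case/andP=> xk _; rewrite ltnNge; apply: contraTN xk => /(nth_default 0)->. Qed.

Lemma bcomp_nth_le (n p : nat) (x : bcomp n p) (k : nat) : nth 0 x k <= p.
Proof.
have [kx|xk] := ltnP k (size x); last by rewrite nth_default.
by have /(all_nthP 0)/(_ k kx)/andP[] := bcomp_parts x.
Qed.

Lemma bcomp_nth_gt0 (n p : nat) (x : bcomp n p) (k : nat) :
  sumn (take k x) < n -> 0 < nth 0 x k.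
Proof.
have [kx _|xk] := ltnP k (size x); last by rewrite take_oversize // bcomp_sumn ltnn.
by have /(all_nthP 0)/(_ k kx)/andP[] := bcomp_parts x.
Qed.

Lemma bcomp_sumn_take_le (n p : nat) (x : bcomp n p) (k : nat) :
  sumn (take k x) <= n.
Proof. by rewrite -[leqRHS](bcomp_sumn x) leq_sumn_take. Qed.

(* The first gap between the partial sums gives a position with [1 < x_k]; the
   last such position [k] has [x_(k+1) < p], since otherwise the gap would
   persist at [k + 1]. *)
Lemma lt_bcomp_descent (n p : nat) (x y : bcomp n p) : 2 <= p -> (y < x)%O ->
  exists2 k, descent p x k & sumn (take k.+1 y) < sumn (take k.+1 x).
Proof.
move=> p2; rewrite Order.POrderTheory.lt_neqAle => /andP[neq_yx /bcomp_dominatedP le_yx].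
have gap : exists k, sumn (take k y) < sumn (take k x).
  (* Lengths up to [n] suffice: a composition of [n] has at most [n] parts, so longer prefixes all
     sum to [n]. *)
  have [/existsP[k gk]|/existsPn nogap] := boolP [exists k : 'I_n.+1, sumn (take k y) < sumn (take k x)].
    by exists k.
  case/eqP: neq_yx; apply/val_inj/eq_sumn_take; [exact: bcomp_gt0 | exact: bcomp_gt0 |].
  move=> k; apply/eqP; rewrite eqn_leq le_yx leqNgt /=.
  have [kn|nk] := leqP k n; first exact: (nogap (Ordinal (kn : k < n.+1))).
  have full z : sumn (take k (z : bcomp n p)) = n.
    by rewrite take_oversize ?bcomp_sumn // (leq_trans (bcomp_size z)) // ltnW.
  by rewrite !full ltnn.
pose P k := (1 < nth 0 x k) && (sumn (take k.+1 y) < sumn (take k.+1 x)).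
have exP : exists k, P k.
  (* Just before the first gap the sums agree, so the next part of [x] exceeds that of [y], which is
     positive because [y] has not yet reached [n]. *)
  case: (ex_minnP gap) => -[|k] gk mink; first by rewrite !take0 in gk.
  have eqk : sumn (take k y) = sumn (take k x).
    apply/eqP; rewrite eqn_leq le_yx leqNgt /=.
    by apply/negP => /mink; rewrite ltnn.
  exists k; rewrite /P gk andbT.
  have yk : sumn (take k y) < n.
    have := bcomp_sumn_take_le x k.+1; move: gk; rewrite (sumn_takeS y); lia.
  move: gk; rewrite !sumn_takeS eqk ltn_add2l; apply: leq_ltn_trans.
  exact: bcomp_nth_gt0.
have boundP k : P k -> k <= size x.
  by case/andP=> xk _; apply: contraTT xk; rewrite -ltnNge => /ltnW/(nth_default 0)->.
case: (ex_maxnP exP boundP) => k /andP[xk gk] maxk.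
exists k => //; rewrite /descent xk ltnNge; apply/negP => pk.
have /maxk : P k.+1; last by rewrite ltnn.
rewrite /P (leq_trans p2 pk) (sumn_takeS y k.+1) (sumn_takeS x k.+1).
by have := bcomp_nth_le y k.+1; lia.
Qed.

(** If [y] is below [x], some [lower k x] fits between them, and covering forces equality with [y].
    Conversely, [lower k x] differs from [x] by one in a single partial sum, which leaves no room in
    between. *)
Lemma lower_cover_lowerP (n p : nat) (x y : bcomp n p) : 2 <= p ->
  reflect (exists2 k, descent p x k & val y = lower k x) (lower_cover y x).
Proof.
move=> p2.
have lower_lt k (z : bcomp n p) : descent p x k -> val z = lower k x -> (z < x)%O.
  move=> /andP[xk _] zE.
  have zS j := @sumn_take_lower k j x xk; rewrite Order.POrderTheory.lt_neqAle.
  apply/andP; split.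
    by apply/eqP => zx; have := zS k.+1; rewrite -zE zx eqxx /=; lia.
  by apply/bcomp_dominatedP => j; rewrite -zS -zE /= leq_addr.
apply: (iffP andP) => [[lt_yx /forallP cov]|[k dk yE]].
  have [k dk gk] := lt_bcomp_descent p2 lt_yx.
  exists k => //.
  have xk : 1 < nth 0 x k by case/andP: dk.
  have bz : is_bcomp n p (lower k x) by apply: is_bcomp_lower => //; case: (x).
  pose z := BComp bz.
  have lt_zx : (z < x)%O by exact: (lower_lt k).
  have le_yz : (y <= z)%O.
    (* The strict gap [gk] absorbs the unit lost at [k.+1]; the other partial sums are those of
       [x]. *)
    apply/bcomp_dominatedP => j; have := @sumn_take_lower k j x xk.
    have /bcomp_dominatedP/(_ j) := Order.POrderTheory.ltW lt_yx.
    by case: eqP => [->|_] /=; lia.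
  have := cov z; rewrite le_yz (Order.POrderTheory.ltW lt_zx) /= !inE.
  by case/orP=> /eqP zE; [rewrite -zE | rewrite zE Order.POrderTheory.ltxx in lt_zx].
have xk : 1 < nth 0 x k by case/andP: dk.
have yS j := @sumn_take_lower k j x xk; rewrite -yE /= in yS.
split; first exact: lower_lt yE.
apply/forallP => z; apply/implyP => /andP[/bcomp_dominatedP yz /bcomp_dominatedP zx].
have yzx j : j != k.+1 -> sumn (take j y) = sumn (take j x).
  by move=> /negPf jk; rewrite -yS jk addn0.
have zE (w : bcomp n p) : (forall j, sumn (take j z) = sumn (take j w)) -> z = w.
  by move=> zw; apply/val_inj/eq_sumn_take => //; exact: bcomp_gt0.
have := yS k.+1; rewrite eqxx !inE => Syx.
(* The sum for [z] at [k.+1] lies between two consecutive integers; its value decides between [y]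
   and [x]. *)
have := yz k.+1; rewrite leq_eqVlt => /orP[/eqP zk|zk].
  apply/orP; left; apply/eqP/zE => j; have [->//|/yzx jk] := eqVneq j k.+1.
  by have := yz j; have := zx j; lia.
apply/orP; right; apply/eqP/zE => j; have [->|/yzx jk] := eqVneq j k.+1.
  by have := zx k.+1; lia.
by have := yz j; have := zx j; lia.
Qed.

(** * Compositions with exactly one descent *)

Definition descents (p : nat) (x : seq nat) : seq nat :=
  [seq k <- iota 0 (size x) | descent p x k].

Lemma mem_descents (p : nat) (x : seq nat) (k : nat) :
  (k \in descents p x) = descent p x k.
Proof.
rewrite mem_filter mem_iota /= add0n andb_idr //; exact: descent_lt_size.
Qed.

(** Distinct descents give distinct covers, since among them only [lower k x] has a smaller sum over
    the first [k.+1] parts. *)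
Lemma card_lower_cover (n p : nat) (x : bcomp n p) : 2 <= p ->
  #|[pred y | lower_cover y x]| = size (descents p x).
Proof.
move=> p2; rewrite cardE -(size_map val) -(size_map (lower^~ x)).
apply/perm_size/uniq_perm; first by rewrite (map_inj_uniq val_inj) enum_uniq.
  rewrite map_inj_in_uniq ?filter_uniq ?iota_uniq // => k l.
  rewrite !mem_descents => /andP[xk _] /andP[xl _] kl.
  have := @sumn_take_lower k k.+1 x xk; have := @sumn_take_lower l k.+1 x xl.
  by rewrite kl eqxx eqSS; case: eqP => //; lia.
move=> s; apply/mapP/mapP => [[y]|[k]].
  rewrite mem_enum inE => /(lower_cover_lowerP _ _ p2)[k dk yE] ->.
  by exists k; rewrite ?mem_descents.
rewrite mem_descents => dk ->.
have bz : is_bcomp n p (lower k x) by apply: is_bcomp_lower => //; case: (x).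
by exists (BComp bz) => //; rewrite mem_enum inE; apply/lower_cover_lowerP => //; exists k.
Qed.

Lemma size_descents_cons (p a : nat) (x : seq nat) :
  size (descents p (a :: x)) = ((1 < a) && (head 0 x < p)) + size (descents p x).
Proof.
rewrite !size_filter /= -[X in iota X _]addn0 iotaDl count_map /=.
by rewrite {1}/descent /= nth0.
Qed.

Lemma size_descents_nseq1 (p i : nat) (x : seq nat) :
  size (descents p (nseq i 1 ++ x)) = size (descents p x).
Proof. by elim: i => //= i IHi; rewrite size_descents_cons. Qed.

Definition ji_shape (p i c j l : nat) : seq nat :=
  nseq i 1 ++ c :: nseq j p ++ nseq l 1.

(** The last part above [1] is the descent. Any earlier part above [1] is followed by [p]; the
    induction on [j] lets that [p] take the role of [c]. *)
Lemma size_descents_ji_shape (p i c j l : nat) : 1 < c <= p ->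
  size (descents p (ji_shape p i c j l)) = 1.
Proof.
move=> /andP[c1 cp]; have p1 := leq_trans c1 cp.
rewrite size_descents_nseq1; elim: j c c1 {cp} => [|j IHj] c c1.
  rewrite size_descents_cons c1 /= -[nseq l 1]cats0 size_descents_nseq1.
  by case: l => [|l] /=; rewrite ?p1 // ltnW.
by rewrite size_descents_cons /= IHj // ltnn andbF.
Qed.

(** The last part above [1] would be followed by [1] or by nothing, hence be a descent. *)
Lemma descents_nil (p : nat) (x : seq nat) : 2 <= p ->
  all (fun i => 1 <= i <= p) x -> size (descents p x) = 0 ->
  x = nseq (size x) 1.
Proof.
move=> p2; elim: x => //= a x IHx /andP[pa px].
rewrite size_descents_cons => /eqP; rewrite addn_eq0 => /andP[a1 /eqP/(IHx px) xE].
congr cons => //; move: a1; rewrite xE; case: (size x) => [|m] /=; lia.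
Qed.

Lemma descents_singleton (p : nat) (x : seq nat) : 2 <= p ->
  all (fun i => 1 <= i <= p) x -> size (descents p x) = 1 ->
  exists i c j l, 1 < c <= p /\ x = ji_shape p i c j l.
Proof.
move=> p2; elim: x => //= a x IHx /andP[pa px].
rewrite size_descents_cons; case: (boolP (_ && _)) => /= [/andP[a1 _]|na].
  move=> [/(descents_nil p2 px) xE]; exists 0, a, 0, (size x).
  by rewrite /ji_shape /= -xE a1; case/andP: pa.
move=> /(IHx px)[i [c [j [l [cp xE]]]]].
have [a1|a1] := leqP a 1.
  by exists i.+1, c, j, l; rewrite xE; have -> : a = 1 by lia.
(* Here [a] exceeds [1] without being a descent, so the next part is [p]: there are no leading ones,
   [c] equals [p], and it joins the block of [p]s while [a] becomes the new [c]. *)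
move: na; rewrite a1 xE /=; case: i xE => [|i] xE /=; last by rewrite p2.
move=> cp'; exists 0, a, j.+1, l; split; first by lia.
by rewrite /ji_shape /=; have -> : c = p by lia.
Qed.

Lemma join_irreducibleP (n p : nat) (x : bcomp n p) : 2 <= p ->
  reflect (exists i c j l, 1 < c <= p /\ val x = ji_shape p i c j l)
          (join_irreducible x).
Proof.
move=> p2; rewrite /join_irreducible card_lower_cover //.
apply: (iffP eqP) => [|[i [c [j [l [cp ->]]]]]]; last exact: size_descents_ji_shape.
exact/descents_singleton/bcomp_parts.
Qed.

(** * Runs of ones at both ends *)

(** A longer run of ones would force [x] to start with [1]; the default [0] of [head] covers empty
    [x]. *)
Lemma leading_ones_cat (i : nat) (x : seq nat) : head 0 x != 1 ->
  leading_ones (nseq i 1 ++ x) = i.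
Proof.
move=> x1; apply/eqP; rewrite eqn_leq; apply/andP; split.
  apply/bigmax_leqP => k; rewrite prefixE size_nseq => /eqP kE.
  rewrite leqNgt; apply: contraNN x1 => ik.
  have := nth_take 0 ik (nseq i 1 ++ x).
  by rewrite kE nth_nseq ik nth_cat size_nseq ltnn subnn nth0 => <-.
have ilt : i < (size (nseq i 1 ++ x)).+1 by rewrite ltnS size_cat size_nseq leq_addr.
by apply: (leq_bigmax_cond (Ordinal ilt)); rewrite /= prefix_prefix.
Qed.

Lemma trailing_ones_rev (x : seq nat) : trailing_ones x = leading_ones (rev x).
Proof.
rewrite /trailing_ones /leading_ones size_rev.
by apply: eq_bigl => k; rewrite /suffix rev_nseq.
Qed.

Lemma leading_ones_ji_shape (p i c j l : nat) : 1 < c ->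
  leading_ones (ji_shape p i c j l) = i.
Proof. by move=> c1; rewrite leading_ones_cat //=; case: c c1 => [|[]]. Qed.

Lemma trailing_ones_ji_shape (p i c j l : nat) : 1 < c <= p ->
  trailing_ones (ji_shape p i c j l) = l.
Proof.
move=> /andP[c1 cp]; rewrite trailing_ones_rev /ji_shape -cat_cons catA rev_cat.
rewrite rev_nseq leading_ones_cat //.
have -> s : head 0 (rev s) = last 0 s.
  by case/lastP: s => // s z; rewrite rev_rcons last_rcons.
(* The part just before the final ones is [c] or [p], and both exceed [1]. *)
rewrite last_cat /=; have := mem_last c (nseq j p).
by rewrite inE mem_nseq => /orP[|/andP[_]] /eqP->; lia.
Qed.

(** * Edges and their compositions *)

Lemma psi_seq_ji_shape (n p a b : nat) :
  psi_seq n p a b =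
    ji_shape p (a - 1) ((b - a) %% p).+1 ((b - a) %/ p) (n - b).
Proof. by []. Qed.

Lemma sumn_ji_shape (p i c j l : nat) :
  sumn (ji_shape p i c j l) = i + c + j * p + l.
Proof. by rewrite sumn_cat /= sumn_cat !sumn_nseq; lia. Qed.

(** With [a = i.+1] and [b = n - l], the difference [b - a] is [j * p + c.-1] with [c.-1 < p], so
    [j] is its quotient and [c.-1] its remainder. *)
Lemma ji_shape_psi_seq (n p i c j l : nat) :
  1 < c <= p -> sumn (ji_shape p i c j l) = n ->
  ji_shape p i c j l = psi_seq n p i.+1 (n - l).
Proof.
move=> cp; rewrite sumn_ji_shape => nE; rewrite psi_seq_ji_shape.
have -> : n - l - i.+1 = j * p + c.-1 by lia.
have cp1 : c.-1 < p by lia.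
rewrite modnMDl divnMDl ?modn_small ?divn_small ?addn0 //; last by lia.
have [-> ->] : c.-1.+1 = c /\ n - (n - l) = l by lia.
by rewrite subn1.
Qed.

Lemma turan_adjE (p a b : nat) : a < b -> turan_adj p a b = (0 < (b - a) %% p).
Proof.
by move=> ab; rewrite /turan_adj eq_sym eqn_mod_dvd ?(ltnW ab) // /dvdn lt0n.
Qed.

(** Adjacency makes the remainder nonzero, which is exactly what puts the distinguished part above
    [1]. *)
Lemma turan_psi_shape (p a b : nat) : 2 <= p -> a < b -> turan_adj p a b ->
  1 < ((b - a) %% p).+1 <= p.
Proof. by move=> p2 ab; rewrite turan_adjE // ltnS => ->; rewrite ltn_mod ltnW. Qed.

Lemma is_bcomp_psi_seq (n p a b : nat) :
  2 <= p -> 0 < a < b -> b <= n -> turan_adj p a b ->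
  is_bcomp n p (psi_seq n p a b).
Proof.
move=> p2 /andP[a0 ab] bn /(turan_psi_shape p2 ab)/andP[_ cp].
apply/and3P; split; first by rewrite size_cat /= addnS.
  rewrite psi_seq_ji_shape sumn_ji_shape; have := divn_eq (b - a) p; lia.
by rewrite all_cat /= all_cat !all_nseq cp (ltnW p2) !leqnn !orbT.
Qed.

Local Open Scope fset_scope.

Lemma fset2_lt_inj (a b c d : nat) : a < b -> c < d ->
  [fset a; b] = [fset c; d] -> a = c /\ b = d.
Proof.
move=> ab cd /fsetP eq_ab; have := eq_ab a; have := eq_ab b; have := eq_ab c.
have := eq_ab d; rewrite !inE !eqxx /= !orbT; lia.
Qed.

Lemma turan_edgesP (n p : nat) (e : {fset nat}) :
  reflect (exists a b, [/\ 0 < a < b, b <= n, turan_adj p a b & e = [fset a; b]])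
          (e \in turan_edges n p).
Proof.
have vertE i : (i \in turan_vertices n) = (0 < i <= n).
  by rewrite !inE mem_iota add1n ltnS.
apply: (iffP (imfset2P _ _ _ _ _)) => [[a /= aV [b /=]]|[a [b [/andP[a0 ab] bn adj ->]]]].
  rewrite vertE in aV; rewrite inE vertE => /andP[bV adj] ->.
  (* The edge set is built from ordered pairs; swapping the ends if necessary gives the increasing
     one. *)
  have [ab|ba|abE] := ltngtP a b; last by rewrite /turan_adj abE eqxx in adj.
    by exists a, b; split=> //; lia.
  exists b, a; split=> //; try lia; last by rewrite fsetUC.
  by rewrite /turan_adj eq_sym.
exists a => /=; first by rewrite vertE a0 (leq_trans (ltnW ab)).
by exists b => //=; rewrite inE vertE adj bn (leq_trans a0 (ltnW ab)).
Qed.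

(** * The two inverse maps *)

(** An edge is an unordered set with no chosen ends, so the correspondence is first stated as a
    relation, the common graph of both maps. *)
Definition psi_rel (n p : nat) (e : {fset nat}) (x : seq nat) : Prop :=
  exists a b, [/\ 0 < a < b, b <= n, turan_adj p a b, e = [fset a; b]
                & x = psi_seq n p a b].

Lemma psi_relE (n p : nat) (e : {fset nat}) (x : seq nat) (a b : nat) :
  psi_rel n p e x -> e = [fset a; b] -> a < b -> x = psi_seq n p a b.
Proof.
move=> [c [d [/andP[_ cd] _ _ -> ->]]] eq_cd ab.
by have [-> ->] := fset2_lt_inj cd ab eq_cd.
Qed.

Lemma psi_rel_inj (n p : nat) (e : {fset nat}) (x y : seq nat) :
  psi_rel n p e x -> psi_rel n p e y -> x = y.
Proof.
by move=> ex [a [b [/andP[_ ab] _ _ eE ->]]]; apply: psi_relE ex eE ab.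
Qed.

(** The composition determines its edge: this gives both the formula for the inverse and the
    injectivity of the correspondence. *)
Lemma psi_rel_phi (n p : nat) (e : {fset nat}) (x : seq nat) :
  2 <= p -> psi_rel n p e x ->
  e = [fset (leading_ones x).+1; n - trailing_ones x].
Proof.
move=> p2 [a [b [/andP[a0 ab] bn adj -> ->]]].
have /andP[c1 cp] := turan_psi_shape p2 ab adj.
rewrite psi_seq_ji_shape leading_ones_ji_shape // trailing_ones_ji_shape ?c1 //.
by rewrite subKn // subn1 prednK.
Qed.

Lemma psi_rel_total (n p : nat) (e : turan_edges n p) : 2 <= p ->
  exists x : {x : bcomp n p | join_irreducible x},
    psi_rel n p (val e) (val (val x)).
Proof.
move=> p2; have /turan_edgesP[a [b [a0b bn adj eE]]] := valP e.
have xP := is_bcomp_psi_seq p2 a0b bn adj; have /andP[a0 ab] := a0b.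
have xJ : join_irreducible (BComp xP).
  apply/join_irreducibleP => //; rewrite /= psi_seq_ji_shape.
  by do 4!eexists; split; last reflexivity; exact: turan_psi_shape.
by exists (Sub (BComp xP) xJ), a, b.
Qed.

Lemma psi_rel_surj (n p : nat) (x : {x : bcomp n p | join_irreducible x}) :
  2 <= p -> exists e : turan_edges n p, psi_rel n p (val e) (val (val x)).
Proof.
move=> p2; have /(join_irreducibleP _ p2)[i [c [j [l [cp xE]]]]] := valP x.
have sx : sumn (ji_shape p i c j l) = n by rewrite -xE bcomp_sumn.
have nE := sx; rewrite sumn_ji_shape in nE.
have ab : 0 < i.+1 < n - l by lia.
have adj : turan_adj p i.+1 (n - l).
  rewrite turan_adjE; last by case/andP: ab.
  have -> : n - l - i.+1 = (j * p + c.-1)%N by lia.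
  by rewrite modnMDl modn_small; lia.
have eP : [fset i.+1; n - l] \in turan_edges n p.
  by apply/turan_edgesP; exists i.+1, (n - l); rewrite leq_subr.
exists [` eP], i.+1, (n - l); split=> //; first exact: leq_subr.
by rewrite xE; exact: ji_shape_psi_seq.
Qed.

Theorem mainTheorem2 (n p : nat) (hn : 2 <= n) (hp : 2 <= p) :
  exists (Psi : turan_edges n p -> join_irr n p)
         (Phi : join_irr n p -> turan_edges n p),
    [/\ forall (e : turan_edges n p) (a b : nat),
          val e = [fset a; b] -> a < b ->
          val (val (Psi e)) = psi_seq n p a b,
        forall x : join_irr n p,
          val (Phi x) = [fset (leading_ones (val x)).+1;
                              n - trailing_ones (val x)],
        bijective Psi,
        cancel Psi Phi
      & cancel Phi Psi].
Proof.
(* Edges and join-irreducibles form finite types, so totality in each direction yields functions by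
   finite choice. *)
have [Psi PsiP] := fin_all_exists (fun e : turan_edges n p => psi_rel_total e hp).
have [Phi PhiP] := fin_all_exists (fun x => @psi_rel_surj n p x hp).
have PsiK : cancel Psi Phi.
  (* Both [e] and [Phi (Psi e)] are related to the composition [Psi e], which determines its
     edge. *)
  by move=> e; apply/val_inj; rewrite (psi_rel_phi hp (PhiP _)) -(psi_rel_phi hp (PsiP e)).
have PhiK : cancel Phi Psi.
  by move=> x; apply/val_inj/val_inj/(psi_rel_inj (PsiP _) (PhiP x)).
exists Psi, Phi; split=> //.
- by move=> e a b; exact: psi_relE (PsiP e).
- by move=> x; exact: psi_rel_phi hp (PhiP x).
- by exists Phi.
Qed.
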